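(* Let $(\mathbf c^k)_{k\in\mathbb N}$, $(\tilde{\mathbf c}^k)_{k\in\mathbb N}$ be generated by any one of the seven primal-dual splitting schemes PDS-I, ..., PDS-VII (listed in the context, with the stated condition on $\mathbf M,\mathbf\Gamma$), and let $\mathbf c^\star\in\mathrm{zer}\,\mathcal A$ be a saddle point. Then the generalized Bregman distance $\Pi(\cdot,\mathbf c^\star)$ generated by $f(\mathbf x)+g^*(\mathbf p)$ between the ergodic point $\frac1k\sum_{i=0}^{k-1}\tilde{\mathbf c}^i$ and $\mathbf c^\star$ has a rate of $O(1/k)$: for every $k\ge1$, $$0\le\Pi\Big(\frac1k\sum_{i=0}^{k-1}\tilde{\mathbf c}^i,\ \mathbf c^\star\Big)\le\frac1{2k}\,\big\|\mathbf c^0-\mathbf c^\star\big\|_{\mathcal S}^2 .$$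
   Context: Let $f:\mathbb R^N\to\mathbb R\cup\{+\infty\}$ and $g:\mathbb R^M\to\mathbb R\cup\{+\infty\}$ be proper, lower semicontinuous and convex, $g^*$ the Fenchel conjugate of $g$, and $\mathbf A:\mathbb R^N\to\mathbb R^M$ linear. Let $\mathcal L(\mathbf x,\mathbf p)=f(\mathbf x)+\langle\mathbf p,\mathbf A\mathbf x\rangle-g^*(\mathbf p)$. Write $\mathbf c=(\mathbf x,\mathbf p)\in\mathbb R^N\times\mathbb R^M$ and $$\Pi(\mathbf c,\mathbf c')=\mathcal L(\mathbf x,\mathbf p')-\mathcal L(\mathbf x',\mathbf p).$$ For $\mathbf c^\star=(\mathbf x^\star,\mathbf p^\star)\in\mathrm{zer}\,\mathcal A$ (with $\mathcal A$ below), $\Pi(\mathbf c,\mathbf c^\star)$ is the generalized Bregman distance $q(\mathbf c)-q(\mathbf c^\star)-\langle\mathbf v,\mathbf c-\mathbf c^\star\rangle$ of $q(\mathbf x,\mathbf p)=f(\mathbf x)+g^*(\mathbf p)$ with $\mathbf v=(-\mathbf A^\top\mathbf p^\star,\mathbf A\mathbf x^\star)\in\partial q(\mathbf c^\star)$. $\mathbb S_{++}$ denotes symmetric positive definite matrices; $X\succ Y$ means $X-Y\in\mathbb S_{++}$; $\|\mathbf c\|_{\mathcal S}^2=\langle\mathbf c,\mathcal S\mathbf c\rangle$; $\mathbf I$ is the identity; $\mathrm{prox}_\varphi^{B}(\mathbf u)=\arg\min_{\mathbf w}\varphi(\mathbf w)+\frac12\|\mathbf w-\mathbf u\|_B^2$.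 Condition for all schemes: $\mathbf M\in\mathbb S_{++}$ ($N\times N$), $\mathbf\Gamma\in\mathbb S_{++}$ ($M\times M$), $\mathbf M\succ\mathbf A^\top\mathbf\Gamma^{-1}\mathbf A$ (equivalently $\mathbf\Gamma\succ\mathbf A\mathbf M^{-1}\mathbf A^\top$). Let $$\mathcal A=\begin{bmatrix}\partial f&\mathbf A^\top\\-\mathbf A&\partial g^*\end{bmatrix},\qquad\mathrm{zer}\,\mathcal A=\{\mathbf c:0\in\mathcal A\mathbf c\}.$$ Each scheme is a generalized proximal point algorithm $$0\in\mathcal A\tilde{\mathbf c}^k+\mathcal Q(\tilde{\mathbf c}^k-\mathbf c^k),\qquad\mathbf c^{k+1}=\mathbf c^k+\mathcal M(\tilde{\mathbf c}^k-\mathbf c^k),$$ where $\tilde{\mathbf c}^k=(\tilde{\mathbf x}^k,\tilde{\mathbf p}^k)$ is the proximal output, and $\mathcal S=\mathcal Q\mathcal M^{-1}$. The schemes: PDS-I: $\mathcal Q=\begin{bmatrix}\mathbf M&-\mathbf A^\top\\-\mathbf A&\mathbf\Gamma\end{bmatrix}$, $\mathcal M=\mathbf I$; i.e. $\mathbf x^{k+1}=\mathrm{prox}_f^{\mathbf M}(\mathbf x^k-\mathbf M^{-1}\mathbf A^\top\mathbf p^k)$, $\mathbf p^{k+1}=\mathrm{prox}_{g^*}^{\mathbf\Gamma}(\mathbf p^k+\mathbf\Gamma^{-1}\mathbf A(2\mathbf x^{k+1}-\mathbf x^k))$. PDS-II: $\mathcal Q=\begin{bmatrix}\mathbf M&\mathbf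 A^\top\\\mathbf A&\mathbf\Gamma\end{bmatrix}$, $\mathcal M=\mathbf I$; i.e. $\mathbf p^{k+1}=\mathrm{prox}_{g^*}^{\mathbf\Gamma}(\mathbf p^k+\mathbf\Gamma^{-1}\mathbf A\mathbf x^k)$, $\mathbf x^{k+1}=\mathrm{prox}_f^{\mathbf M}(\mathbf x^k-\mathbf M^{-1}\mathbf A^\top(2\mathbf p^{k+1}-\mathbf p^k))$. PDS-III: $\mathcal Q=\begin{bmatrix}\mathbf M&0\\\mathbf A&\mathbf\Gamma\end{bmatrix}$, $\mathcal M=\begin{bmatrix}\mathbf I-\mathbf M^{-1}\mathbf A^\top\mathbf\Gamma^{-1}\mathbf A&-\mathbf M^{-1}\mathbf A^\top\\0&\mathbf I\end{bmatrix}$; i.e. $\mathbf p^{k+1}=\mathrm{prox}_{g^*}^{\mathbf\Gamma}(\mathbf p^k+\mathbf\Gamma^{-1}\mathbf A\mathbf x^k)$, $\tilde{\mathbf x}^k=\mathrm{prox}_f^{\mathbf M}(\mathbf x^k-\mathbf M^{-1}\mathbf A^\top\mathbf p^{k+1})$, $\mathbf x^{k+1}=\tilde{\mathbf x}^k-\mathbf M^{-1}\mathbf A^\top\mathbf\Gamma^{-1}\mathbf A(\tilde{\mathbf x}^k-\mathbf x^k)-\mathbf M^{-1}\mathbf A^\top(\mathbf p^{k+1}-\mathbf p^k)$. PDS-IV: $\mathcal Q=\begin{bmatrix}\mathbf M&-\mathbf A^\top\\0&\mathbf\Gamma\end{bmatrix}$, $\mathcal M=\begin{bmatrix}\mathbf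 I&0\\\mathbf\Gamma^{-1}\mathbf A&\mathbf I-\mathbf\Gamma^{-1}\mathbf A\mathbf M^{-1}\mathbf A^\top\end{bmatrix}$; i.e. $\mathbf x^{k+1}=\mathrm{prox}_f^{\mathbf M}(\mathbf x^k-\mathbf M^{-1}\mathbf A^\top\mathbf p^k)$, $\tilde{\mathbf p}^k=\mathrm{prox}_{g^*}^{\mathbf\Gamma}(\mathbf p^k+\mathbf\Gamma^{-1}\mathbf A\mathbf x^{k+1})$, $\mathbf p^{k+1}=\tilde{\mathbf p}^k-\mathbf\Gamma^{-1}\mathbf A\mathbf M^{-1}\mathbf A^\top(\tilde{\mathbf p}^k-\mathbf p^k)+\mathbf\Gamma^{-1}\mathbf A(\mathbf x^{k+1}-\mathbf x^k)$. PDS-V: $\mathcal Q=\begin{bmatrix}\mathbf M&0\\\mathbf A&\mathbf\Gamma\end{bmatrix}$, $\mathcal M=\begin{bmatrix}\mathbf I&0\\\mathbf\Gamma^{-1}\mathbf A&\mathbf I\end{bmatrix}$; i.e. $\tilde{\mathbf p}^k=\mathrm{prox}_{g^*}^{\mathbf\Gamma}(\mathbf p^k+\mathbf\Gamma^{-1}\mathbf A\mathbf x^k)$, $\mathbf x^{k+1}=\mathrm{prox}_f^{\mathbf M}(\mathbf x^k-\mathbf M^{-1}\mathbf A^\top\tilde{\mathbf p}^k)$, $\mathbf p^{k+1}=\tilde{\mathbf p}^k+\mathbf\Gamma^{-1}\mathbf A(\mathbf x^{k+1}-\mathbf x^k)$. PDS-VI: $\mathcal Q=\begin{bmatrix}\mathbf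 M&-\mathbf A^\top\\0&\mathbf\Gamma\end{bmatrix}$, $\mathcal M=\begin{bmatrix}\mathbf I&-\mathbf M^{-1}\mathbf A^\top\\0&\mathbf I\end{bmatrix}$; i.e. $\tilde{\mathbf x}^k=\mathrm{prox}_f^{\mathbf M}(\mathbf x^k-\mathbf M^{-1}\mathbf A^\top\mathbf p^k)$, $\mathbf p^{k+1}=\mathrm{prox}_{g^*}^{\mathbf\Gamma}(\mathbf p^k+\mathbf\Gamma^{-1}\mathbf A\tilde{\mathbf x}^k)$, $\mathbf x^{k+1}=\tilde{\mathbf x}^k-\mathbf M^{-1}\mathbf A^\top(\mathbf p^{k+1}-\mathbf p^k)$. PDS-VII: $\mathcal Q=\begin{bmatrix}\mathbf M&-\mathbf A^\top\\\mathbf A&\mathbf\Gamma\end{bmatrix}$, $\mathcal M=\begin{bmatrix}\mathbf I&-\mathbf M^{-1}\mathbf A^\top\\\mathbf\Gamma^{-1}\mathbf A&\mathbf I\end{bmatrix}$; i.e. $\tilde{\mathbf x}^k=\mathrm{prox}_f^{\mathbf M}(\mathbf x^k-\mathbf M^{-1}\mathbf A^\top\mathbf p^k)$, $\tilde{\mathbf p}^k=\mathrm{prox}_{g^*}^{\mathbf\Gamma}(\mathbf p^k+\mathbf\Gamma^{-1}\mathbf A\mathbf x^k)$, $\mathbf x^{k+1}=\tilde{\mathbf x}^k-\mathbf M^{-1}\mathbf A^\top(\tilde{\mathbf p}^k-\mathbf p^k)$, $\mathbf p^{k+1}=\tilde{\mathbf p}^k+\mathbf\Gamma^{-1}\mathbf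 A(\tilde{\mathbf x}^k-\mathbf x^k)$. *)

(* Defs.v *)
From HB Require Import structures.
From mathcomp Require Export all_boot all_order all_algebra.
From mathcomp Require Export all_classical all_reals all_analysis.
Export Order.TTheory GRing.Theory Num.Theory.
Export numFieldNormedType.Exports.
#[export] Set Implicit Arguments.
#[export] Unset Strict Implicit.
#[export] Unset Printing Implicit Defensive.

Local Open Scope classical_set_scope.
Local Open Scope ring_scope.

Definition dot (R : realType) (n : nat) (u v : 'cV[R]_n) : R :=
  \sum_(i < n) u i 0 * v i 0.

Definition sqnorm (R : realType) (n : nat) (B : 'M[R]_n) (u : 'cV[R]_n) : R :=
  dot u (B *m u).

Definition sympos (R : realType) (n : nat) (B : 'M[R]_n) : Prop :=
  B^T = B /\ (forall u : 'cV[R]_n, u != 0 -> 0 < dot u (B *m u)).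

Section ConvexAnalysis.
Context (R : realType) (n : nat).
Implicit Types (phi : 'cV[R]_n -> \bar R) (x y u w : 'cV[R]_n).
Local Open Scope ereal_scope.

Definition proper_fun phi : Prop :=
  (forall x, phi x != -oo) /\ (exists x, phi x != +oo).

(* For functions that avoid -oo; at t = 0 and t = 1 the convention 0 * +oo = 0
   makes the inequality trivial. *)
Definition convex_efun phi : Prop :=
  forall x y (t : R), (0 <= t <= 1)%R ->
    phi (t *: x + (1 - t) *: y)%R <= t%:E * phi x + (1 - t)%:E * phi y.

Definition proper_lsc_convex phi : Prop :=
  [/\ proper_fun phi, lower_semicontinuous phi & convex_efun phi].

Definition conjugate phi u : \bar R :=
  ereal_sup [set (dot u y)%:E - phi y | y in [set: 'cV[R]_n]].

(* Empty outside the effective domain of phi.  For proper phi the first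
   conjunct is implied by the second. *)
Definition subdiff phi x : set 'cV[R]_n :=
  [set u | phi x \is a fin_num /\
           forall y, phi x + (dot u (y - x)%R)%:E <= phi y].

(* The set of minimizers; [w = prox_phi^B u] is rendered [prox phi B u w]. *)
Definition prox phi (B : 'M[R]_n) u : set 'cV[R]_n :=
  [set w | forall z, phi w + (2^-1 * sqnorm B (w - u))%:E
                  <= phi z + (2^-1 * sqnorm B (z - u))%:E].

End ConvexAnalysis.

Section SaddlePoint.
Context (R : realType) (n m : nat).
Variables (f : 'cV[R]_n -> \bar R) (g : 'cV[R]_m -> \bar R) (A : 'M[R]_(m, n)).
Implicit Types c : 'cV[R]_(n + m).
Local Open Scope ereal_scope.

(* Since +oo - +oo = -oo, [lagrangian x p] is the intended value as soon as
   f x or conjugate g p is finite. *)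
Definition lagrangian (x : 'cV[R]_n) (p : 'cV[R]_m) : \bar R :=
  f x + (dot p (A *m x)%R)%:E - conjugate g p.

(* A primal-dual point c = (x, p) is the column vector stacking x over p:
   x = usubmx c and p = dsubmx c.  When c2 is a zero of [pd_operator] below,
   f (usubmx c2) and conjugate g (dsubmx c2) are finite, so that no
   indeterminate +oo - +oo occurs. *)
Definition bregman c1 c2 : \bar R :=
  lagrangian (usubmx c1) (dsubmx c2) - lagrangian (usubmx c2) (dsubmx c1).

Definition pd_operator c : set 'cV[R]_(n + m) :=
  [set v | exists u w,
     [/\ subdiff f (usubmx c) u,
         subdiff (conjugate g) (dsubmx c) w
       & v = col_mx (u + A^T *m dsubmx c)%R (- (A *m usubmx c) + w)%R]].

Definition zer_pd : set 'cV[R]_(n + m) := [set c | pd_operator c 0%R].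

End SaddlePoint.

Variant pds :=
  PDS_I | PDS_II | PDS_III | PDS_IV | PDS_V | PDS_VI | PDS_VII.

Section Schemes.
Context (R : realType) (n m : nat).
Variables (f : 'cV[R]_n -> \bar R) (g : 'cV[R]_m -> \bar R) (A : 'M[R]_(m, n)).
Variables (Mx : 'M[R]_n) (Gam : 'M[R]_m).
Implicit Types c ct : nat -> 'cV[R]_(n + m).

Local Notation Mi := (invmx Mx).
Local Notation Gi := (invmx Gam).

(* Mx and Gam are the metrics of the primal and dual updates; pdsM is the
   relaxation matrix. *)
Definition pdsQ (s : pds) : 'M[R]_(n + m) :=
  match s with
  | PDS_I   => block_mx Mx (- A^T) (- A) Gam
  | PDS_II  => block_mx Mx A^T     A     Gam
  | PDS_III => block_mx Mx 0       A     Gam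
  | PDS_IV  => block_mx Mx (- A^T) 0     Gam
  | PDS_V   => block_mx Mx 0       A     Gam
  | PDS_VI  => block_mx Mx (- A^T) 0     Gam
  | PDS_VII => block_mx Mx (- A^T) A     Gam
  end.

Definition pdsM (s : pds) : 'M[R]_(n + m) :=
  match s with
  | PDS_I   => 1%:M
  | PDS_II  => 1%:M
  | PDS_III => block_mx (1%:M - Mi *m A^T *m Gi *m A) (- (Mi *m A^T)) 0 1%:M
  | PDS_IV  => block_mx 1%:M 0 (Gi *m A) (1%:M - Gi *m A *m Mi *m A^T)
  | PDS_V   => block_mx 1%:M 0 (Gi *m A) 1%:M
  | PDS_VI  => block_mx 1%:M (- (Mi *m A^T)) 0 1%:M
  | PDS_VII => block_mx 1%:M (- (Mi *m A^T)) (Gi *m A) 1%:M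
  end.

Definition pdsS (s : pds) : 'M[R]_(n + m) := pdsQ s *m invmx (pdsM s).

Definition ppa_generated (s : pds) c ct : Prop :=
  forall k : nat,
    (exists2 v, pd_operator f g A (ct k) v
              & 0 = v + pdsQ s *m (ct k - c k)) /\
    c k.+1 = c k + pdsM s *m (ct k - c k).

(* One explicit iteration: (x, p) is the current point, (xt, pt) the proximal
   output and (x', p') the next point. *)
Definition prox_step (s : pds) (x xt x' : 'cV[R]_n) (p pt p' : 'cV[R]_m) : Prop :=
  let proxf := prox f Mx in
  let proxg := prox (conjugate g) Gam in
  match s with
  | PDS_I =>
      [/\ proxf (x - Mi *m A^T *m p) x',
          proxg (p + Gi *m A *m (2 *: x' - x)) p',
          xt = x' & pt = p']
  | PDS_II =>
      [/\ proxg (p + Gi *m A *m x) p',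
          proxf (x - Mi *m A^T *m (2 *: p' - p)) x',
          xt = x' & pt = p']
  | PDS_III =>
      [/\ proxg (p + Gi *m A *m x) p',
          proxf (x - Mi *m A^T *m p') xt,
          x' = xt - Mi *m A^T *m Gi *m A *m (xt - x) - Mi *m A^T *m (p' - p)
        & pt = p']
  | PDS_IV =>
      [/\ proxf (x - Mi *m A^T *m p) x',
          proxg (p + Gi *m A *m x') pt,
          p' = pt - Gi *m A *m Mi *m A^T *m (pt - p) + Gi *m A *m (x' - x)
        & xt = x']
  | PDS_V =>
      [/\ proxg (p + Gi *m A *m x) pt,
          proxf (x - Mi *m A^T *m pt) x',
          p' = pt + Gi *m A *m (x' - x)
        & xt = x']
  | PDS_VI =>
      [/\ proxf (x - Mi *m A^T *m p) xt,
          proxg (p + Gi *m A *m xt) p',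
          x' = xt - Mi *m A^T *m (p' - p)
        & pt = p']
  | PDS_VII =>
      [/\ proxf (x - Mi *m A^T *m p) xt,
          proxg (p + Gi *m A *m x) pt,
          x' = xt - Mi *m A^T *m (pt - p)
        & p' = pt + Gi *m A *m (xt - x)]
  end.

Definition prox_generated (s : pds) c ct : Prop :=
  forall k : nat,
    prox_step s (usubmx (c k)) (usubmx (ct k)) (usubmx (c k.+1))
                (dsubmx (c k)) (dsubmx (ct k)) (dsubmx (c k.+1)).

(* The two descriptions of a scheme, as a generalized proximal point algorithm
   and as explicit proximal updates, are equivalent under the standing
   assumptions; either one may be used to generate the sequences. *)
Definition pds_generated (s : pds) c ct : Prop :=
  ppa_generated s c ct \/ prox_generated s c ct.

End Schemes.

(* Main.v *)
Require Import Defs.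
From mathcomp Require Import ring lra.

(* The subgradient inequalities at the proximal output give
     Pi(ct, cstar) <= <Q (c - ct), ct - cstar> = <S (c - c+), ct - cstar>,
   and since S is symmetric the right-hand side equals
     1/2 (|c - cstar|_S^2 - |c+ - cstar|_S^2) - 1/2 |c - ct|_G^2
   with G = Q + Q^T - M^T Q.  In each of the seven schemes both M^T Q and G are
   positive definite: they are block matrices with a pivot and a Schur complement
   among Mx, Gam, Mx - A^T Gam^-1 A and Gam - A Mx^-1 A^T, possibly increased by
   A^T Gam^-1 A or A Mx^-1 A^T.  Telescoping, together with the
   convexity of Pi(., cstar), gives the rate; Pi(., cstar) >= 0 is the
   subgradient inequality at cstar, since Pi is antisymmetric. *)

Local Open Scope classical_set_scope.
Local Open Scope ring_scope.

(** * The Euclidean inner product *)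

Lemma dotE (R : realType) n (u v : 'cV[R]_n) : dot u v = (u^T *m v) 0 0.
Proof. by rewrite mxE; apply: eq_bigr => i _; rewrite mxE. Qed.

Lemma dotC (R : realType) n (u v : 'cV[R]_n) : dot u v = dot v u.
Proof. by apply: eq_bigr => i _; rewrite mulrC. Qed.

Lemma dotDr (R : realType) n (u v w : 'cV[R]_n) :
  dot u (v + w) = dot u v + dot u w.
Proof. by rewrite !dotE mulmxDr mxE. Qed.

Lemma dotDl (R : realType) n (u v w : 'cV[R]_n) :
  dot (v + w) u = dot v u + dot w u.
Proof. by rewrite dotC dotDr !(dotC u). Qed.

Lemma dotZr (R : realType) n (a : R) (u v : 'cV[R]_n) :
  dot u (a *: v) = a * dot u v.
Proof. by rewrite !dotE -scalemxAr mxE. Qed.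

Lemma dotZl (R : realType) n (a : R) (u v : 'cV[R]_n) :
  dot (a *: u) v = a * dot u v.
Proof. by rewrite dotC dotZr dotC. Qed.

Lemma dotNr (R : realType) n (u v : 'cV[R]_n) : dot u (- v) = - dot u v.
Proof. by rewrite -scaleN1r dotZr mulN1r. Qed.

Lemma dotNl (R : realType) n (u v : 'cV[R]_n) : dot (- u) v = - dot u v.
Proof. by rewrite dotC dotNr dotC. Qed.

Lemma dot0r (R : realType) n (u : 'cV[R]_n) : dot u 0 = 0.
Proof. by rewrite -(scale0r (0 : 'cV[R]_n)) dotZr mul0r. Qed.

Lemma dot0l (R : realType) n (u : 'cV[R]_n) : dot 0 u = 0.
Proof. by rewrite dotC dot0r. Qed.

Lemma dot_mulmxr (R : realType) n m (B : 'M[R]_(m, n)) (p : 'cV[R]_m) x :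
  dot p (B *m x) = dot (B^T *m p) x.
Proof. by rewrite !dotE trmx_mul trmxK mulmxA. Qed.

Lemma dot_mulmxl (R : realType) n m (B : 'M[R]_(m, n)) x (p : 'cV[R]_m) :
  dot (B *m x) p = dot x (B^T *m p).
Proof. by rewrite dotC dot_mulmxr dotC. Qed.

Lemma dot_col_mx (R : realType) n m (x x' : 'cV[R]_n) (p p' : 'cV[R]_m) :
  dot (col_mx x p) (col_mx x' p') = dot x x' + dot p p'.
Proof. by rewrite !dotE tr_col_mx mul_row_col mxE. Qed.

Definition dotl := (dotDl, dotDr, dotNl, dotNr, dotZl, dotZr, dot0l, dot0r).

Lemma dot_sym_mx (R : realType) n (B : 'M[R]_n) u v :
  B^T = B -> dot u (B *m v) = dot v (B *m u).
Proof. by move=> symB; rewrite dotC dot_mulmxl symB. Qed.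

Lemma sympos_tr (R : realType) n (B : 'M[R]_n) : sympos B -> B^T = B.
Proof. by case. Qed.

Lemma sqnorm_ge0 (R : realType) n (B : 'M[R]_n) u :
  sympos B -> 0 <= sqnorm B u.
Proof.
move=> [_ posB]; have [->|/posB/ltW//] := eqVneq u 0.
by rewrite /sqnorm mulmx0 dot0l.
Qed.

Lemma sympos_unit (R : realType) n (B : 'M[R]_n) : sympos B -> B \in unitmx.
Proof.
move=> [symB posB]; rewrite unitmxE unitfE; apply/det0P => -[v v0 vB].
have : B *m v^T = 0 by rewrite -symB -trmx_mul vB trmx0.
have /posB : v^T != 0 by rewrite trmx_eq0.
by move=> + Bv; rewrite Bv dot0r ltxx.
Qed.

Lemma trmx_invmx_sympos (R : realType) n (B : 'M[R]_n) :
  sympos B -> (invmx B)^T = invmx B.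
Proof. by move=> [symB _]; rewrite trmx_inv symB. Qed.

Lemma sympos_invmx (R : realType) n (B : 'M[R]_n) :
  sympos B -> sympos (invmx B).
Proof.
move=> hB; have uB := sympos_unit hB.
split; first exact: trmx_invmx_sympos.
move=> u u0; have -> : u = B *m (invmx B *m u) by rewrite mulKVmx.
rewrite mulKmx // dotC; apply: hB.2.
by apply: contra_neq u0 => Bu; rewrite -[u](mulKVmx uB) Bu mulmx0.
Qed.

Lemma sqnorm_block_mx (R : realType) n m (B11 : 'M[R]_n) B12 B21
    (B22 : 'M[R]_m) x p :
  sqnorm (block_mx B11 B12 B21 B22) (col_mx x p) =
  dot x (B11 *m x) + dot x (B12 *m p) + dot p (B21 *m x) + dot p (B22 *m p).
Proof. by rewrite /sqnorm mul_block_col dot_col_mx !dotDr !addrA. Qed.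

Lemma col_mx_neq0 (R : realType) n m (x : 'cV[R]_n) (p : 'cV[R]_m) :
  (col_mx x p != 0) = (x != 0) || (p != 0).
Proof. by rewrite col_mx_eq0 negb_and. Qed.

(* Complete the square in the second variable. *)
Lemma sympos_schur_lower (R : realType) n m (B11 : 'M[R]_n) (B : 'M[R]_(m, n))
    (B22 : 'M[R]_m) :
  sympos B22 -> sympos (B11 - B^T *m invmx B22 *m B) ->
  sympos (block_mx B11 B^T B B22).
Proof.
move=> h22 hS; have u22 := sympos_unit h22.
have sym22i := trmx_invmx_sympos h22.
split.
  rewrite tr_block_mx trmxK h22.1; congr block_mx.
  (* The subtracted term is symmetric, so cancelling it leaves the symmetry of [B11]. *)
  have := hS.1; rewrite linearB /= !trmx_mul trmxK sym22i mulmxA.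
  by move/addIr.
move=> c; rewrite -[c]vsubmxK; move: (usubmx c) (dsubmx c) => x p.
rewrite col_mx_neq0 => xp0; rewrite -/(sqnorm _ _) sqnorm_block_mx.
have -> : dot x (B11 *m x) + dot x (B^T *m p) + dot p (B *m x) +
    dot p (B22 *m p) = sqnorm (B11 - B^T *m invmx B22 *m B) x +
    sqnorm B22 (p + invmx B22 *m (B *m x)).
  rewrite /sqnorm mulmxBl mulmxDr mulKVmx // !dotl -!mulmxA.
  rewrite [dot (_ *m _) (B22 *m p)]dot_mulmxl sym22i mulKmx //.
  rewrite -dot_mulmxl (dotC (invmx B22 *m _)) (dot_mulmxl B x p).
  by rewrite [dot (B *m x) _]dot_mulmxl; ring.
(* If [x] is nonzero the Schur term is positive; otherwise [p] is nonzero and the square is the form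
   of [B22] at [p]. *)
have [x0|x0] := eqVneq x 0; last first.
  by rewrite ltr_pwDl ?sqnorm_ge0 //; apply: hS.2.
rewrite ltr_wpDl ?sqnorm_ge0 //; apply: h22.2.
by move: xp0; rewrite x0 eqxx !mulmx0 addr0.
Qed.

(** Exchanging the two coordinate blocks reduces this to completing the square in the other
    variable. *)
Lemma sympos_schur_upper (R : realType) n m (B11 : 'M[R]_n) (B : 'M[R]_(m, n))
    (B22 : 'M[R]_m) :
  sympos B11 -> sympos (B22 - B *m invmx B11 *m B^T) ->
  sympos (block_mx B11 B^T B B22).
Proof.
move=> h11 hS.
have hS' : sympos (B22 - B^T^T *m invmx B11 *m B^T) by rewrite trmxK.
have [symC posC] := sympos_schur_lower h11 hS'.
split.
  by move: symC; rewrite !tr_block_mx !trmxK => /eq_block_mx[-> _ _ ->].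
move=> c; rewrite -[c]vsubmxK; move: (usubmx c) (dsubmx c) => x p.
rewrite col_mx_neq0 orbC -col_mx_neq0 => /posC.
rewrite -!/(sqnorm _ _) !sqnorm_block_mx trmxK.
by congr (0 < _); ring.
Qed.

(** For fixed [p] the block form is minimal at x = - B11^-1 B^T p, and its value there is the form
    of the Schur complement at [p]. *)
Lemma sympos_schur_complement (R : realType) n m (B11 : 'M[R]_n)
    (B : 'M[R]_(m, n)) (B22 : 'M[R]_m) :
  sympos B11 -> sympos (block_mx B11 B^T B B22) ->
  sympos (B22 - B *m invmx B11 *m B^T).
Proof.
move=> h11 [symC posC]; have sym11i := trmx_invmx_sympos h11.
split.
  rewrite linearB /= !trmx_mul trmxK sym11i mulmxA.
  by move: symC; rewrite tr_block_mx trmxK => /eq_block_mx[_ _ _ ->].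
move=> p p0.
have := posC (col_mx (- (invmx B11 *m (B^T *m p))) p).
rewrite col_mx_neq0 p0 orbT => /(_ isT).
rewrite -/(sqnorm _ _) sqnorm_block_mx !mulmxN mulKVmx ?sympos_unit //.
rewrite mulmxBl !dotl -!mulmxA.
by congr (0 < _); ring.
Qed.

Lemma sympos_block_diag (R : realType) n m (B11 : 'M[R]_n) (B22 : 'M[R]_m) :
  sympos B11 -> sympos B22 -> sympos (block_mx B11 0 0 B22).
Proof.
move=> h11 h22; rewrite -[X in block_mx _ X]trmx0.
by apply: sympos_schur_upper => //; rewrite mul0mx mul0mx subr0.
Qed.

Lemma symposD_congr (R : realType) n m (B : 'M[R]_n) (C : 'M[R]_m)
    (A : 'M[R]_(m, n)) :
  sympos B -> sympos C -> sympos (B + A^T *m C *m A).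
Proof.
move=> hB hC; split.
  by rewrite linearD /= !trmx_mul trmxK hB.1 hC.1 mulmxA.
move=> u u0; rewrite mulmxDl dotDr ltr_pwDl ?hB.2 //.
rewrite -!mulmxA -dot_mulmxl.
exact: sqnorm_ge0.
Qed.

(* [M^T Q] is congruent to the metric [S = Q M^-1], while [Q + Q^T - M^T Q]
   controls the descent of the squared [S]-distance to a saddle point. *)
Lemma pds_metrics (R : realType) n m (A : 'M[R]_(m, n)) (Mx : 'M[R]_n)
    (Gam : 'M[R]_m) (s : pds) :
  sympos Mx -> sympos Gam -> sympos (Mx - A^T *m invmx Gam *m A) ->
  let P := (pdsM A Mx Gam s)^T *m pdsQ A Mx Gam s in
  sympos P /\ sympos (pdsQ A Mx Gam s + (pdsQ A Mx Gam s)^T - P).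
Proof.
move=> hM hG hMG.
have uM := sympos_unit hM; have uG := sympos_unit hG.
have hMi := sympos_invmx hM; have hGi := sympos_invmx hG.
have trN k l (B : 'M[R]_(k, l)) : (- B)^T = - B^T by rewrite linearN.
have trB k l (B C : 'M[R]_(k, l)) : (B - C)^T = B^T - C^T by rewrite linearB.
have hplus : sympos (block_mx Mx A^T A Gam) by exact: sympos_schur_lower.
have hminus : sympos (block_mx Mx (- A^T) (- A) Gam).
  rewrite -trN; apply: sympos_schur_lower => //.
  by rewrite trN !mulNmx !mulmxN opprK.
(* Passing through the block matrix turns the condition on [Mx] into its equivalent form on
   [Gam]. *)
have hGM := sympos_schur_complement hM hplus.
have hMK := symposD_congr A hM hGi.
have hGL : sympos (Gam + A *m invmx Mx *m A^T).
  by rewrite -[A in A *m _ *m _]trmxK; exact: symposD_congr.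
(* The added term is chosen so that the Schur complement is exactly [Mx]; dually, it is [Gam] in
   [hGLb]. *)
have hMKb : sympos (block_mx (Mx + A^T *m invmx Gam *m A) A^T A Gam).
  by apply: sympos_schur_lower => //; rewrite addrK.
have hGLb : sympos (block_mx Mx (- A^T) (- A) (Gam + A *m invmx Mx *m A^T)).
  rewrite -trN; apply: sympos_schur_upper => //.
  by rewrite trN !mulNmx !mulmxN opprK addrK.
have symM := sympos_tr hM; have symG := sympos_tr hG.
have symMi := sympos_tr hMi; have symGi := sympos_tr hGi.
have mulMiM k (B : 'M[R]_(k, n)) : B *m invmx Mx *m Mx = B by rewrite mulmxKV.
have mulGiG k (B : 'M[R]_(k, m)) : B *m invmx Gam *m Gam = B by rewrite mulmxKV.
have tr0 k l : (0 : 'M[R]_(k, l))^T = 0 by rewrite trmx0.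
have tr1 k : (1%:M : 'M[R]_k)^T = 1%:M by rewrite trmx1.
have trE := (trN, trB, @trmxK R, tr0, tr1, symM, symG, symMi, symGi).
have oppK k l (B : 'M[R]_(k, l)) : - - B = B by rewrite opprK.
have mulE := (mul0mx, mulmx0, mul1mx, mulmx1, addr0, add0r, mulmxBl, mulmxN,
  mulNmx, mulmxA, mulMiM, mulGiG, oppK, oppr0).
have blockE : forall P' G' : 'M[R]_(n + m),
    (pdsM A Mx Gam s)^T *m pdsQ A Mx Gam s = P' ->
    pdsQ A Mx Gam s + (pdsQ A Mx Gam s)^T - P' = G' -> sympos P' -> sympos G' ->
    let P := (pdsM A Mx Gam s)^T *m pdsQ A Mx Gam s in
    sympos P /\ sympos (pdsQ A Mx Gam s + (pdsQ A Mx Gam s)^T - P).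
  by move=> P' G' EP EG hP hG' P; rewrite /P EP EG.
case: s blockE; rewrite /pdsM /pdsQ => blockE.
(* In the first two schemes M = I and Q is symmetric, so both metrics equal Q. *)
- apply: (blockE _ _ _ _ hminus hminus); first by rewrite trmx1 mul1mx.
  by rewrite (sympos_tr hminus) addrK.
- apply: (blockE _ _ _ _ hplus hplus); first by rewrite trmx1 mul1mx.
  by rewrite (sympos_tr hplus) addrK.
(* In PDS-III and PDS-IV the relaxation makes P block diagonal. PDS-V and PDS-VI give the same two
   pairs with the roles of P and G exchanged. *)
- apply: (blockE _ _ _ _ (sympos_block_diag hMG hG) hMKb).
    rewrite tr_block_mx mulmx_block !trE !trmx_mul !trE !mulE.
    by rewrite addNr.
  rewrite tr_block_mx !trE opp_block_mx !add_block_mx !mulE.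
  by rewrite addrK opprB addrA addrAC addrK.
- apply: (blockE _ _ _ _ (sympos_block_diag hM hGM) hGLb).
    rewrite tr_block_mx mulmx_block !trE !trmx_mul !trE !mulE.
    by rewrite addNr.
  rewrite tr_block_mx !trE opp_block_mx !add_block_mx !mulE.
  by rewrite addrK opprB addrA addrAC addrK.
- apply: (blockE _ _ _ _ hMKb (sympos_block_diag hMG hG)).
    by rewrite tr_block_mx mulmx_block !trE !trmx_mul !trE !mulE.
  rewrite tr_block_mx !trE opp_block_mx !add_block_mx !mulE.
  by rewrite addrK opprD addrA addrK !subrr.
- apply: (blockE _ _ _ _ hGLb (sympos_block_diag hM hGM)).
    rewrite tr_block_mx mulmx_block !trE !trmx_mul !trE !mulE.
    by rewrite [_ + Gam]addrC.
  rewrite tr_block_mx !trE opp_block_mx !add_block_mx !mulE.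
  by rewrite addrK opprD addrA addrK !addNr.
(* In PDS-VII the off-diagonal blocks cancel in both metrics. *)
- apply: (blockE _ _ _ _ (sympos_block_diag hMK hGL)
    (sympos_block_diag hMG hGM)).
    rewrite tr_block_mx mulmx_block !trE !trmx_mul !trE !mulE.
    by rewrite !addNr [_ + Gam]addrC.
  rewrite tr_block_mx !trE opp_block_mx !add_block_mx !mulE.
  by rewrite !opprD !addrA !addrK addNr subrr.
Qed.

(** * Descent of a relaxed step in the metric Q M^-1 *)

Lemma sqnormD (R : realType) n (B : 'M[R]_n) u v : B^T = B ->
  sqnorm B (u + v) = sqnorm B u + 2 * dot v (B *m u) + sqnorm B v.
Proof.
by move=> symB; rewrite /sqnorm mulmxDr !dotl (dot_sym_mx u v symB); ring.
Qed.

Lemma sqnormZ (R : realType) n (B : 'M[R]_n) t u :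
  sqnorm B (t *: u) = t ^+ 2 * sqnorm B u.
Proof. by rewrite /sqnorm -scalemxAr !dotl; ring. Qed.

Lemma relaxation_unit (R : realType) n (Q M : 'M[R]_n) :
  sympos (M^T *m Q) -> M \in unitmx.
Proof. by move=> /sympos_unit; rewrite unitmx_mul unitmx_tr => /andP[]. Qed.

(** This congruence transfers symmetry and positivity from M^T Q to S, although Q itself need not be
    symmetric. *)
Lemma relaxation_metricE (R : realType) n (Q M : 'M[R]_n) :
  sympos (M^T *m Q) ->
  Q *m invmx M = (invmx M)^T *m (M^T *m Q) *m invmx M.
Proof.
move=> /relaxation_unit uM.
by rewrite !mulmxA -trmx_mul mulmxV // trmx1 mul1mx.
Qed.

Lemma relaxation_metric_sym (R : realType) n (Q M : 'M[R]_n) :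
  sympos (M^T *m Q) -> (Q *m invmx M)^T = Q *m invmx M.
Proof.
move=> hP; rewrite (relaxation_metricE hP).
by rewrite trmx_mul [(_^T *m _)^T]trmx_mul (sympos_tr hP) trmxK mulmxA.
Qed.

Lemma relaxation_metric_ge0 (R : realType) n (Q M : 'M[R]_n) u :
  sympos (M^T *m Q) -> 0 <= sqnorm (Q *m invmx M) u.
Proof.
move=> hP; rewrite (relaxation_metricE hP) /sqnorm -!mulmxA -dot_mulmxl.
by rewrite [M^T *m _]mulmxA; exact: sqnorm_ge0.
Qed.

(** Here [e] stands for c - cstar and [d] for ct - c. Expanding with S M = Q, the right side minus
    the left is half the form of Q + Q^T - M^T Q at [d]. *)
Lemma relaxation_descent (R : realType) n (Q M : 'M[R]_n) e d :
  sympos (M^T *m Q) -> sympos (Q + Q^T - M^T *m Q) ->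
  dot (- (Q *m d)) (e + d) <=
  2^-1 * (sqnorm (Q *m invmx M) e - sqnorm (Q *m invmx M) (e + M *m d)).
Proof.
move=> hP hG; have uM := relaxation_unit hP.
have symS := relaxation_metric_sym hP.
rewrite (sqnormD _ _ symS) (dot_sym_mx _ _ symS) /sqnorm -!mulmxA mulKmx //.
have := sqnorm_ge0 d hG.
rewrite /sqnorm mulmxBl mulmxDl !dotl -mulmxA -!dot_mulmxl !(dotC (Q *m d)).
by lra.
Qed.

(** * Conjugates, Jensen's inequality and proximal points *)

Section Convex.
Context (R : realType) (n : nat).
Implicit Types (phi : 'cV[R]_n -> \bar R) (x y u w : 'cV[R]_n).
Local Open Scope ereal_scope.

Lemma proper_fun_fin phi : proper_fun phi -> exists x, phi x \is a fin_num.
Proof. by move=> [hN [x hx]]; exists x; rewrite fin_numE hN hx. Qed.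

Lemma conjugate_neqNy phi u : proper_fun phi -> conjugate phi u != -oo.
Proof.
move=> /proper_fun_fin[y hy]; rewrite -ltNye.
apply: lt_le_trans (ereal_sup_ubound _); last by exists y.
by rewrite -(fineK hy) -EFinB ltNyr.
Qed.

(** A conjugate is a supremum of affine functions; points where [phi] is +oo contribute only -oo. *)
Lemma convex_conjugate phi : proper_fun phi -> convex_efun (conjugate phi).
Proof.
move=> [hN _] u u' t /andP[t0 t1]; apply: ge_ereal_sup => _ [y _ <-].
case E : (phi y) => [r| |]; last 1 first.
- by have := hN y; rewrite E.
- have le_conj v : (dot v y - r)%:E <= conjugate phi v.
    by rewrite EFinB -E; apply: ereal_sup_ubound; exists y.
  rewrite -EFinB !dotl.
  have -> : (t * dot u y + (1 - t) * dot u' y - r =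
    t * (dot u y - r) + (1 - t) * (dot u' y - r))%R by ring.
  rewrite EFinD !EFinM; apply: leeD; apply: lee_wpmul2l;
    by rewrite ?lee_fin ?subr_ge0 ?le_conj.
- by rewrite /= leNye.
Qed.

Lemma jensen_mean phi (x : nat -> 'cV[R]_n) k :
  (forall z, phi z != -oo) -> convex_efun phi ->
  (forall i, phi (x i) \is a fin_num) -> (0 < k)%N ->
  phi (k%:R^-1 *: \sum_(0 <= i < k) x i)%R <=
  (k%:R^-1 * \sum_(0 <= i < k) fine (phi (x i)))%:E.
Proof.
move=> hN hphi hx; case: k => // k _.
elim: k => [|k IH]; first by rewrite !big_nat1 invr1 scale1r mul1r fineK.
have k0 : (k.+1%:R : R) != 0%R by rewrite pnatr_eq0.
have k1 : (k.+2%:R : R) != 0%R by rewrite pnatr_eq0.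
have kE : (1 - k.+2%:R^-1 = k.+1%:R / k.+2%:R :> R)%R.
  apply: (mulIf k1).
  by rewrite mulrBl mulVf // mul1r divfK // -[k.+2%:R]natr1 addrK.
have kE' : ((1 - k.+2%:R^-1) / k.+1%:R = k.+2%:R^-1 :> R)%R.
  by rewrite kE mulrC mulKf.
have t0 : (0 <= k.+2%:R^-1 :> R)%R by rewrite invr_ge0 ler0n.
have t1 : (k.+2%:R^-1 <= 1 :> R)%R by rewrite invf_le1 ?ltr0n ?ler1n.
rewrite !(big_nat_recr k.+1) //=.
set m := (\sum_(0 <= i < k.+1) x i)%R in IH *.
(* The mean of k+2 points is a convex combination of the new point, with weight 1/(k+2), and the
   mean of the first k+1. *)
have -> : (k.+2%:R^-1 *: (m + x k.+1) = k.+2%:R^-1 *: x k.+1 +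
    (1 - k.+2%:R^-1) *: (k.+1%:R^-1 *: m))%R.
  by rewrite scalerA kE' scalerDr addrC.
have := hphi (x k.+1) (k.+1%:R^-1 *: m)%R k.+2%:R^-1%R.
rewrite t0 t1 => /(_ isT)/le_trans; apply.
set a := (\sum_(0 <= i < k.+1) _)%R in IH *.
have -> : (k.+2%:R^-1 * (a + fine (phi (x k.+1))) =
    k.+2%:R^-1 * fine (phi (x k.+1)) + (1 - k.+2%:R^-1) * (k.+1%:R^-1 * a))%R.
  by rewrite [(_ * (_ * a))%R]mulrA kE' mulrDr addrC.
rewrite [leRHS]EFinD !EFinM fineK //; apply: leeD => //.
by apply: lee_wpmul2l => //; rewrite lee_fin kE divr_ge0.
Qed.

Lemma subdiff_fine_le phi x y u : subdiff phi x u -> phi y \is a fin_num ->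
  (fine (phi x) + dot u (y - x) <= fine (phi y))%R.
Proof.
by move=> [hx hsub] hy; rewrite -lee_fin EFinD !fineK //; exact: hsub.
Qed.

(** First-order optimality: compare [w] with points of the segment towards [y] and let them approach
    [w]. *)
Lemma prox_subdiff phi (B : 'M[R]_n) u w : sympos B ->
  (forall z, phi z != -oo) -> convex_efun phi ->
  (exists z, phi z \is a fin_num) -> prox phi B u w ->
  subdiff phi w (B *m (u - w))%R.
Proof.
move=> hB hN hphi [z0 hz0] hprox.
(* Comparison with [z0], where the objective is finite, excludes +oo. *)
have hw : phi w \is a fin_num.
  rewrite fin_numE hN -ltey.
  have := hprox z0; rewrite -(fineK hz0) -EFinD.
  by case: (phi w) => [r| |]; rewrite ?ltry ?addye ?leye_eq.
split=> // y; have := hN y.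
case E : (phi y) => [r| |] // _; last by rewrite leey.
rewrite -(fineK hw) -EFinD lee_fin.
set a := fine (phi w).
set s := sqnorm B (y - w); have s0 : (0 <= s)%R by exact: sqnorm_ge0.
rewrite -[(u - w)%R]opprB mulmxN dotNl dotC.
set b := dot (y - w) (B *m (w - u)).
(* Minimality at w + t (y - w), bounded by convexity, after division by t. *)
have step (t : R) : (0 < t)%R -> (t <= 1)%R -> (a - r - b <= 2^-1 * t * s)%R.
  move=> t0 t1.
  have := hphi y w t; rewrite E (ltW t0) t1 => /(_ isT).
  rewrite -(fineK hw) -!EFinM -EFinD => hz.
  have := le_trans (hprox (t *: y + (1 - t) *: w)%R) (leeD2r _ hz).
  rewrite -(fineK hw) -!EFinD lee_fin.
  have -> : (t *: y + (1 - t) *: w - u = (w - u) + t *: (y - w))%R.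
    by apply/matrixP => i j; rewrite !mxE; ring.
  rewrite (sqnormD (w - u)%R (t *: _)%R hB.1) sqnormZ dotZl -/b -/s -/a => h.
  have {}h : (t * (a - r - b) <= t * (2^-1 * t * s))%R by move: h => /=; lra.
  by rewrite -(ler_pM2l t0).
rewrite leNgt; apply/negP => lt_r.
(* In place of a limit, take t = d / (d + s): it would give d + s <= s / 2, impossible for d > 0 and
   s >= 0. *)
pose d := (a - r - b)%R; have d0 : (0 < d)%R by rewrite /d; move: lt_r; lra.
have ds0 : (0 < d + s)%R by rewrite ltr_pwDl.
have := step (d / (d + s))%R; rewrite divr_gt0 // ler_pdivrMr // mul1r lerDl.
move=> /(_ isT s0); rewrite -/d => h.
have : (d * (d + s) <= d * (2^-1 * s))%R.
  by rewrite -ler_pdivlMr //; move: h; congr (_ <= _)%R; ring.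
rewrite ler_pM2l //; lra.
Qed.

End Convex.

(** * The Bregman distance on the domain of f and the conjugate of g *)

Lemma dot_sumr (R : realType) n I (r : seq I) (P : pred I) u
    (v : I -> 'cV[R]_n) :
  dot u (\sum_(i <- r | P i) v i) = \sum_(i <- r | P i) dot u (v i).
Proof. by elim/big_rec2: _ => [|i _ b _ <-]; rewrite ?dot0r ?dotDr. Qed.

Section PrimalDual.
Context (R : realType) (n m : nat).
Context (f : 'cV[R]_n -> \bar R) (g : 'cV[R]_m -> \bar R) (A : 'M[R]_(m, n)).
Implicit Types c : 'cV[R]_(n + m).

Definition pd_finite c : Prop :=
  f (usubmx c) \is a fin_num /\ conjugate g (dsubmx c) \is a fin_num.

(** With q(x, p) = f(x) + g^*(p), this is q(c1) - q(c2) plus the bilinear terms left when <p2, A x2>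
    cancels in - <v, c1 - c2>, for v = (- A^T p2, A x2). *)
Definition bregman_fine c1 c2 : R :=
  fine (f (usubmx c1)) + fine (conjugate g (dsubmx c1))
  - fine (f (usubmx c2)) - fine (conjugate g (dsubmx c2))
  + dot (dsubmx c2) (A *m usubmx c1) - dot (dsubmx c1) (A *m usubmx c2).

Lemma bregmanE c1 c2 : pd_finite c1 -> pd_finite c2 ->
  bregman f g A c1 c2 = (bregman_fine c1 c2)%:E.
Proof.
move=> [f1 g1] [f2 g2]; rewrite /bregman /lagrangian.
rewrite -(fineK f1) -(fineK g1) -(fineK f2) -(fineK g2).
rewrite -?EFinN -?EFinD -?EFinN -?EFinD.
by congr (_%:E); rewrite /bregman_fine; ring.
Qed.

Lemma pd_operator_finite c v : pd_operator f g A c v -> pd_finite c.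
Proof. by move=> [u [w [[? _] [? _] _]]]. Qed.

(** Add the two subgradient inequalities at [c1], tested at [c2]: the skew part of the operator
    contributes exactly the bilinear terms. *)
Lemma pd_operator_bregman_le c1 c2 v :
  pd_operator f g A c1 v -> pd_finite c2 ->
  bregman_fine c1 c2 <= dot v (c1 - c2).
Proof.
move=> [u [w [hu hw ->]]] [f2 g2].
rewrite -[c1 - c2]vsubmxK !linearB /= dot_col_mx /bregman_fine.
have := subdiff_fine_le hu f2; have := subdiff_fine_le hw g2.
rewrite !dotl -!dot_mulmxr !(dotC (A *m _)).
lra.
Qed.

Lemma bregman_fine_opp c1 c2 : bregman_fine c1 c2 = - bregman_fine c2 c1.
Proof. by rewrite /bregman_fine; ring. Qed.

Lemma bregman_fine_ge0 c cs :
  zer_pd f g A cs -> pd_finite c -> 0 <= bregman_fine c cs.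
Proof.
move=> hcs hc; have := pd_operator_bregman_le hcs hc.
by rewrite dot0l bregman_fine_opp lerNl oppr0.
Qed.
End PrimalDual.

(** * Ergodic averages *)

Section Ergodic.
Context (R : realType) (n m : nat).
Context (f : 'cV[R]_n -> \bar R) (g : 'cV[R]_m -> \bar R) (A : 'M[R]_(m, n)).
Context (hf : proper_fun f) (cvx_f : convex_efun f) (hg : proper_fun g).
Implicit Types (c : 'cV[R]_(n + m)) (ct : nat -> 'cV[R]_(n + m)).

(** Jensen's inequality excludes +oo at the mean, and properness excludes -oo. *)
Lemma pd_finite_mean ct k : (forall i, pd_finite f g (ct i)) -> (0 < k)%N ->
  pd_finite f g (k%:R^-1 *: \sum_(0 <= i < k) ct i).
Proof.
move=> hct k0; split; rewrite !linearZ !linear_sum /= fin_numE -ltey.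
- rewrite hf.1.
  apply: (le_lt_trans (jensen_mean hf.1 cvx_f _ k0)) (ltry _) => i.
  by case: (hct i).
- rewrite conjugate_neqNy //.
  apply: (le_lt_trans (jensen_mean _ (convex_conjugate hg) _ k0)) (ltry _) => i.
    exact: conjugate_neqNy.
  by case: (hct i).
Qed.

(** In its first argument the distance is a convex function plus an affine one: Jensen's inequality
    handles the former, linearity the latter. *)
Lemma bregman_fine_mean ct cs k :
  (forall i, pd_finite f g (ct i)) -> (0 < k)%N ->
  bregman_fine f g A (k%:R^-1 *: \sum_(0 <= i < k) ct i) cs <=
  k%:R^-1 * \sum_(0 <= i < k) bregman_fine f g A (ct i) cs.
Proof.
move=> hct k0; have [finf fing] := pd_finite_mean hct k0.
have hfu i : f (usubmx (ct i)) \is a fin_num by case: (hct i).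
have hgd i : conjugate g (dsubmx (ct i)) \is a fin_num by case: (hct i).
have Ngx p := conjugate_neqNy p hg.
have lef := jensen_mean hf.1 cvx_f hfu k0.
have leg := jensen_mean Ngx (convex_conjugate hg) hgd k0.
set cbar := k%:R^-1 *: _ in finf fing *.
have ubarE : usubmx cbar = k%:R^-1 *: \sum_(0 <= i < k) usubmx (ct i).
  by rewrite /cbar linearZ linear_sum.
have dbarE : dsubmx cbar = k%:R^-1 *: \sum_(0 <= i < k) dsubmx (ct i).
  by rewrite /cbar linearZ linear_sum.
rewrite -ubarE -(fineK finf) lee_fin in lef.
rewrite -dbarE -(fineK fing) lee_fin in leg.
have dotP : dot (dsubmx cs) (A *m usubmx cbar) =
    k%:R^-1 * \sum_(0 <= i < k) dot (dsubmx cs) (A *m usubmx (ct i)).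
  by rewrite ubarE -scalemxAr dotZr mulmx_sumr dot_sumr.
have dotD : dot (dsubmx cbar) (A *m usubmx cs) =
    k%:R^-1 * \sum_(0 <= i < k) dot (dsubmx (ct i)) (A *m usubmx cs).
  by rewrite dbarE dotZl dotC dot_sumr; under eq_bigr do rewrite dotC.
(* The terms depending on [cs] alone are rewritten as means of constants, so that all terms compare
   linearly. *)
have cstE (a : R) : a = k%:R^-1 * \sum_(0 <= i < k) a.
  by rewrite sumr_const_nat subn0 -[a *+ k]mulr_natl mulKf // pnatr_eq0 -lt0n.
rewrite /bregman_fine dotP dotD.
rewrite !(big_split, sumrN) /= !mulrDr !mulrN.
have := cstE (fine (f (usubmx cs))).
have := cstE (fine (conjugate g (dsubmx cs))).
lra.
Qed.
End Ergodic.

(* [ring] does not apply to column vectors: abstract the matrix-vector products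
   and compare entries. *)
Ltac mulmx_ring :=
  repeat match goal with |- context [?B *m ?z] =>
    let y := fresh in set y := (B *m z); clearbody y end;
  apply/matrixP => i j; rewrite !mxE; ring.

(** * From explicit proximal updates to the generalized proximal point form *)

(** The optimality conditions of the two proximal steps supply the subgradients in the inclusion;
    the rest is linear algebra, scheme by scheme. *)
Lemma prox_step_ppa (R : realType) n m (f : 'cV[R]_n -> \bar R)
    (g : 'cV[R]_m -> \bar R) (A : 'M[R]_(m, n)) (Mx : 'M[R]_n) (Gam : 'M[R]_m)
    s x xt x' p pt p' :
  sympos Mx -> sympos Gam ->
  proper_fun f -> convex_efun f -> proper_fun g ->
  (exists p0, conjugate g p0 \is a fin_num) ->
  prox_step f g A Mx Gam s x xt x' p pt p' ->
  let d := col_mx xt pt - col_mx x p in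
  pd_operator f g A (col_mx xt pt) (- (pdsQ A Mx Gam s *m d)) /\
  col_mx x' p' = col_mx x p + pdsM A Mx Gam s *m d.
Proof.
move=> hM hG hf cvx_f hg hdom hstep d.
have uM := sympos_unit hM; have uG := sympos_unit hG.
have proxf u w : prox f Mx u w -> subdiff f w (Mx *m (u - w)).
  by apply: prox_subdiff => //; [exact: hf.1 | exact: proper_fun_fin].
have proxg u w : prox (conjugate g) Gam u w ->
    subdiff (conjugate g) w (Gam *m (u - w)).
  apply: prox_subdiff => //; last exact: convex_conjugate.
  by move=> z; exact: conjugate_neqNy.
split.
{ case: s hstep => /= -[]; move=> *; subst.
  (* Unification with the optimality conditions determines both subgradients, which leaves the
     blockwise identity with - Q d. *)
  all: eexists; eexists; split; rewrite ?col_mxKu ?col_mxKd;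
    try (by [apply: proxf; eassumption | apply: proxg; eassumption]).
  all: rewrite /d opp_col_mx add_col_mx mul_block_col opp_col_mx; congr col_mx.
  all: rewrite -?mulmxA ?(mulmxBr, mulmxDr, mulNmx, mulmxN).
  all: rewrite ?(mulKVmx uM) ?(mulKVmx uG).
  all: rewrite ?mul0mx -?scalemxAr.
  all: mulmx_ring. }
{ case: s hstep => /= -[]; move=> *; subst.
  all: rewrite /d ?mul1mx ?opp_col_mx ?add_col_mx ?mul_block_col ?add_col_mx.
  all: congr col_mx; rewrite -?mulmxA.
  all: rewrite ?(mulmxBr, mulmxDr, mulmxBl, mulNmx, mulmxN, mul1mx, mul0mx).
  all: rewrite -?mulmxA.
  all: mulmx_ring. }
Qed.

Lemma pds_generated_ppa (R : realType) n m (f : 'cV[R]_n -> \bar R)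
    (g : 'cV[R]_m -> \bar R) (A : 'M[R]_(m, n)) (Mx : 'M[R]_n) (Gam : 'M[R]_m)
    s c ct :
  sympos Mx -> sympos Gam ->
  proper_fun f -> convex_efun f -> proper_fun g ->
  (exists p, conjugate g p \is a fin_num) ->
  pds_generated f g A Mx Gam s c ct -> ppa_generated f g A Mx Gam s c ct.
Proof.
move=> hM hG hf cvx_f hg hdom [//|hprox] k.
have := prox_step_ppa hM hG hf cvx_f hg hdom (hprox k).
rewrite !vsubmxK => -[hv ->]; split=> //.
by eexists; [exact: hv | rewrite addNr].
Qed.

(** * Telescoping and the ergodic rate *)

Lemma sum_bregman_le (R : realType) n m (f : 'cV[R]_n -> \bar R)
    (g : 'cV[R]_m -> \bar R) (A : 'M[R]_(m, n)) (Mx : 'M[R]_n) (Gam : 'M[R]_m)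
    s c ct cs k :
  sympos Mx -> sympos Gam -> sympos (Mx - A^T *m invmx Gam *m A) ->
  ppa_generated f g A Mx Gam s c ct -> pd_finite f g cs ->
  \sum_(0 <= i < k) bregman_fine f g A (ct i) cs <=
  2^-1 * sqnorm (pdsS A Mx Gam s) (c 0%N - cs).
Proof.
move=> hM hG hMG hgen hcs.
have [hP hQ] := pds_metrics s hM hG hMG.
pose D i := sqnorm (pdsS A Mx Gam s) (c i - cs).
have step i : bregman_fine f g A (ct i) cs <= 2^-1 * (D i - D i.+1).
  have [[v hv v0] cS] := hgen i.
  apply: (le_trans (pd_operator_bregman_le hv hcs)).
  have -> : v = - (pdsQ A Mx Gam s *m (ct i - c i)).
    by apply/eqP; rewrite -addr_eq0 -v0.
  have -> : ct i - cs = (c i - cs) + (ct i - c i).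
    by rewrite [RHS]addrC addrA addrNK.
  by rewrite /D cS [c i + _ - cs]addrAC; exact: relaxation_descent.
apply: (le_trans (ler_sum _ (fun i _ => step i))).
rewrite -mulr_sumr ler_pM2l ?invr_gt0 ?ltr0n //.
(* Telescoping uses increments f(i+1) - f(i), hence the sign: f = - D. *)
rewrite (telescope_sumr_eq (fun i => - D i)) //; last first.
  by move=> i _; rewrite opprK addrC.
(* The last distance [D k] is nonnegative and is dropped. *)
by rewrite opprK addrC lerBlDr lerDl; exact: relaxation_metric_ge0.
Qed.

Theorem theorem4 (R : realType) (n m : nat)
    (f : 'cV[R]_n -> \bar R) (g : 'cV[R]_m -> \bar R) (A : 'M[R]_(m, n))
    (hf : proper_lsc_convex f) (hg : proper_lsc_convex g)
    (Mx : 'M[R]_n) (Gam : 'M[R]_m)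
    (hM : sympos Mx) (hGam : sympos Gam)
    (hMGam : sympos (Mx - A^T *m invmx Gam *m A))
    (s : pds) (c ct : nat -> 'cV[R]_(n + m))
    (hgen : pds_generated f g A Mx Gam s c ct)
    (cstar : 'cV[R]_(n + m)) (hcstar : zer_pd f g A cstar)
    (k : nat) (hk : (1 <= k)%N) :
  let cbar := k%:R^-1 *: \sum_(0 <= i < k) ct i in
  (0 <= bregman f g A cbar cstar)%E /\
  (bregman f g A cbar cstar <=
     ((2 * k%:R)^-1 * sqnorm (pdsS A Mx Gam s) (c 0%N - cstar))%:E)%E.
Proof.
move=> cbar; have [pf _ cvx_f] := hf; have [pg _ _] := hg.
have fin_star := pd_operator_finite hcstar.
(* The saddle point provides a point where the conjugate is finite, as the optimality condition of
   its proximal step requires. *)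
have hdom : exists p, conjugate g p \is a fin_num.
  by exists (dsubmx cstar); case: fin_star.
have hppa := pds_generated_ppa hM hGam pf cvx_f pg hdom hgen.
(* The inclusion defining each proximal output places it in the domain of the operator. *)
have fin_ct i : pd_finite f g (ct i).
  by have [[v /pd_operator_finite]] := hppa i.
have fin_bar : pd_finite f g cbar by exact: pd_finite_mean.
rewrite bregmanE // !lee_fin; split; first exact: bregman_fine_ge0.
apply: (le_trans (bregman_fine_mean A pf cvx_f pg cstar fin_ct hk)).
rewrite [2 * _]mulrC invfM -mulrA ler_pM2l ?invr_gt0 ?ltr0n //.
exact: sum_bregman_le.
Qed.
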